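(* Let $G$ be a finite group and let $V$ be a finite-dimensional irreducible complex $G$-module. Then the following are equivalent: (i) $V$ is primitive; (ii) for every $d\ge 3$ and every $0\ne f\in\operatorname{Sym}^d(V^* )$, $G$-invariance of $J(f)$ implies $G$-invariance of $\mathbb C f$.
   Context: Elements of $\operatorname{Sym}^d(V^* )$ are homogeneous forms (polynomial functions) of degree $d$ on $V$, and $G$ acts on them by $(g\cdot h)(x)=h(g^{-1}x)$. For $v\in V$, $D_v$ denotes directional differentiation in direction $v$. The Jacobian of $f\in\operatorname{Sym}^d(V^* )$ is the subspace $J(f)=\langle D_vf : v\in V\rangle\subseteq \operatorname{Sym}^{d-1}(V^* )$. A subspace $U$ is $G$-invariant if $g\cdot U=U$ for all $g\in G$. A system of imprimitivity for an irreducible module $V$ is a decomposition $V=V_1\oplus\cdots\oplus V_r$ with $r>1$ into nonzero subspaces which are permuted transitively by $G$; $V$ is primitive if it admits no such decomposition. *)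

(* Defs.v *)
From mathcomp Require Import all_boot all_order all_algebra all_fingroup.
From mathcomp Require Import mxrepresentation.
From mathcomp Require Import classical_sets reals complex mpoly.

Set Implicit Arguments.
Unset Strict Implicit.
Unset Printing Implicit Defensive.

Import GRing.Theory.
Local Open Scope ring_scope.
Local Open Scope classical_set_scope.

Section LinearSpan.
Context {F : fieldType} {V : lmodType F}.

Definition lspan (S : set V) : set V :=
  [set q | exists k (c : 'I_k -> F) (u : 'I_k -> V),
     (forall i, S (u i)) /\ q = \sum_i c i *: u i].

End LinearSpan.

Section Forms.
Context {F : fieldType} {n : nat}.

Definition dderiv (f : {mpoly F[n]}) (v : 'rV[F]_n) : {mpoly F[n]} :=
  \sum_(i < n) v 0 i *: f^`M(i).

Definition jacobian (f : {mpoly F[n]}) : set {mpoly F[n]} :=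
  lspan (range (dderiv f)).

End Forms.

Section Module.
Context {F : fieldType} {gT : finGroupType} {G : {group gT}} {n : nat}.
Variable rG : mx_representation F G n.

(* Matrices of an mx_representation multiply row vectors on the right, so the
   left G-module structure on 'rV_n is g . v = v *m rG g^-1. *)
Definition gact (g : gT) (v : 'rV[F]_n) : 'rV[F]_n := v *m rG (g^-1)%g.

(* (g . h)(x) = h (g^-1 . x): the i-th coordinate of g^-1 . x = x *m rG g is
   substituted for the i-th variable of h; see meval_form_act. *)
Definition form_act (g : gT) (h : {mpoly F[n]}) : {mpoly F[n]} :=
  h \mPo [tuple \sum_(j < n) rG g j i *: 'X_j | i < n].

Lemma meval_form_act (g : gT) (h : {mpoly F[n]}) (x : 'rV[F]_n) :
  (form_act g h).@[x 0] = h.@[gact (g^-1)%g x 0].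
Proof.
rewrite /form_act /gact comp_mpoly_meval invgK; apply: meval_eq => i.
rewrite tnth_mktuple raddf_sum mxE; apply: eq_bigr => j _ /=.
by rewrite mevalZ mevalXU mulrC.
Qed.

Definition form_invariant (U : set {mpoly F[n]}) : Prop :=
  forall g, g \in G -> form_act g @` U = U.

(* The subspaces V_i of V are the row spaces of the matrices W i. *)
Definition imprimitivity_system (r : nat) (W : 'I_r -> 'M[F]_n) : Prop :=
  [/\ (1 < r)%N,
      mxdirect (\sum_i W i) /\ (\sum_i W i == 1%:M)%MS,
      forall i, W i != 0,
      forall g, g \in G -> forall i, exists j, (W i *m rG (g^-1)%g == W j)%MS &
      forall i j, exists2 g, g \in G & (W i *m rG (g^-1)%g == W j)%MS].

Definition primitive_module : Prop :=
  forall r (W : 'I_r -> 'M[F]_n), ~ imprimitivity_system W.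

End Module.

(* Main.v *)
From HB Require Import structures.
Require Import Defs.
From mathcomp Require Import all_boot all_order all_algebra all_fingroup.
From mathcomp Require Import mxrepresentation.
From mathcomp Require Import classical_sets reals complex mpoly.

(** If [V] is primitive and [J(f)] is invariant, irreducibility gives
    [D_v f <> 0] for [v <> 0], so that [D_v (g f) = D_(A_g v) f] for a unique
    linear map [A_g]. Second derivatives commute, hence [A_g] is self-adjoint for
    the form-valued symmetric trilinear map [(u, v, w) |-> D_u D_v D_w f], and,
    as [d >= 3], the [A_g] commute with each other. The cocycle relation between
    [A_(gh)], [A_g] and [A_h] shows that [G] permutes their joint eigenspaces, so
    primitivity forces every [A_g] to be a scalar [c], and then [g f = c f].

    Conversely, given a system of imprimitivity, let [l] be a nonzero linear form
    vanishing on all blocks but one, [W_i0], and let [f_i] be the product of the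
    cubes of the [g l] over the [g] taking [W_i0] to [W_i]. Then [G] permutes
    the [f_i], which live on distinct blocks, so [J(sum_i c_i f_i)] is the direct
    sum of the [J(f_i)], whatever the nonzero coefficients [c_i]; take
    [c = (2, 1, ..., 1)]. *)

Set Implicit Arguments.
Unset Strict Implicit.
Unset Printing Implicit Defensive.

Import GRing.Theory Num.Theory.
Local Open Scope ring_scope.

(** * Linear substitutions and directional derivatives *)

Section LinearSubstitution.
Context {F : fieldType} {n : nat}.
Implicit Types (f h p q : {mpoly F[n]}) (v w : 'rV[F]_n) (M N : 'M[F]_n).

Lemma mpoly_alg_ind (P : {mpoly F[n]} -> Prop) :
  (forall c, P c%:MP) -> (forall i, P 'X_i) ->
  (forall p q, P p -> P q -> P (p + q)) ->
  (forall p q, P p -> P q -> P (p * q)) -> forall p, P p.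
Proof.
move=> PC PX PD PM; elim/mpolyind => [|c m p _ _ Pp]; first by rewrite -mpolyC0.
apply: (PD) => //; rewrite -mul_mpolyC; apply: (PM) => //.
rewrite mpolyXE_id; elim/big_ind: _ => // [|i _]; first by rewrite -mpolyC1.
by elim: (m i) => [|k Pk]; rewrite ?expr0 -?mpolyC1 // exprS; apply: PM.
Qed.

Definition linform (u : 'cV[F]_n) : {mpoly F[n]} := \sum_(j < n) u j 0 *: 'X_j.

(** The pullback of [h] along [x |-> x *m M]. [M] may be singular: besides [rG g], it will be a
    projection onto a block. *)
Definition msubst M h : {mpoly F[n]} := h \mPo [tuple linform (col i M) | i < n].

Lemma form_actE (gT : finGroupType) (G : {group gT})
    (rG : mx_representation F G n) g h : form_act rG g h = msubst (rG g) h.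
Proof.
rewrite /form_act /msubst; congr (_ \mPo _); apply: eq_from_tnth => i.
by rewrite !tnth_mktuple; apply: eq_bigr => j _; rewrite mxE.
Qed.

Lemma msubst_is_linear M : linear (msubst M).
Proof. by move=> c p q; rewrite /msubst linearP. Qed.
HB.instance Definition _ M := GRing.isLinear.Build F {mpoly F[n]} {mpoly F[n]} _
  (msubst M) (msubst_is_linear M).

Lemma msubst_is_monoid_morphism M : monoid_morphism (msubst M).
Proof. by split=> [|p q]; rewrite /msubst ?rmorph1 ?rmorphM. Qed.
HB.instance Definition _ M := GRing.isMonoidMorphism.Build {mpoly F[n]}
  {mpoly F[n]} (msubst M) (msubst_is_monoid_morphism M).

Lemma msubstC M c : msubst M c%:MP = c%:MP.
Proof. exact: comp_mpolyC. Qed.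

Lemma msubstX M i : msubst M 'X_i = linform (col i M).
Proof. by rewrite /msubst comp_mpolyXU -tnth_nth tnth_mktuple. Qed.

Lemma msubst_linform M u : msubst M (linform u) = linform (M *m u).
Proof.
rewrite /linform raddf_sum /=.
under eq_bigr => i _ do rewrite linearZ /= msubstX scaler_sumr.
rewrite exchange_big /=; apply: eq_bigr => j _; rewrite mxE scaler_suml.
by apply: eq_bigr => i _; rewrite scalerA mxE mulrC.
Qed.

Lemma msubst_comp M N h : msubst M (msubst N h) = msubst (M *m N) h.
Proof.
elim/mpoly_alg_ind: h => [c|i|p q IHp IHq|p q IHp IHq].
- by rewrite !msubstC.
- by rewrite !msubstX msubst_linform !colE mulmxA.
- by rewrite !raddfD /= IHp IHq.
- by rewrite !rmorphM /= IHp IHq.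
Qed.

Lemma msubst1 h : msubst 1%:M h = h.
Proof.
rewrite -[RHS]comp_mpoly_id /msubst; congr (_ \mPo _).
apply: eq_from_tnth => i; rewrite !tnth_mktuple /linform (bigD1 i) //=.
rewrite !mxE eqxx scale1r big1 ?addr0 // => j /negPf ji.
by rewrite !mxE ji scale0r.
Qed.

Lemma linform_is_linear : linear linform.
Proof.
move=> c u v; rewrite /linform scaler_sumr -big_split; apply: eq_bigr => j _ /=.
by rewrite !mxE scalerDl scalerA.
Qed.
HB.instance Definition _ := GRing.isLinear.Build F 'cV[F]_n {mpoly F[n]} _
  linform linform_is_linear.

Lemma linform_eq0 u : (linform u == 0) = (u == 0).
Proof.
apply/eqP/eqP=> [l0|->]; last by rewrite raddf0.
apply/matrixP=> i j; rewrite ord1 mxE.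
have /mpolyP/(_ U_(i)%MM) := l0; rewrite mcoeff0 raddf_sum /= (bigD1 i) //=.
rewrite mcoeffZ mcoeffX eqxx mulr1 big1 ?addr0 // => k ki.
rewrite mcoeffZ mcoeffX; case: eqP => [/mnmP/(_ k)|_]; last by rewrite mulr0.
by rewrite !mnm1E eqxx eq_sym (negPf ki).
Qed.

Lemma linform_homog u : linform u \is 1.-homog.
Proof.
by apply: rpred_sum => j _; apply: rpredZ; rewrite dhomogX /= mdeg1.
Qed.

Lemma dhomog_prod_exp (I : finType) (P : pred I) (e : I -> nat) (d : I -> nat)
    (p : I -> {mpoly F[n]}) :
  (forall i, P i -> p i \is (d i).-homog) ->
  \prod_(i | P i) p i ^+ e i \is (\sum_(i | P i) d i * e i)%N.-homog.
Proof.
move=> hp; elim/big_rec2: _ => [|i y x Pi hx]; first exact: dhomog1.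
by apply: dhomogM => //; apply: dhomogMn; apply: hp.
Qed.

Lemma msubst_homog M d h : h \is d.-homog -> msubst M h \is d.-homog.
Proof.
move=> hd; rewrite /msubst comp_mpolyE big_seq; apply: rpred_sum => m mh.
apply: rpredZ; have <- := dhomog_mf hd mh; rewrite /= mdegE.
under eq_bigr => i _ do rewrite tnth_mktuple.
rewrite (eq_bigr (fun i => 1 * m i)%N); last by move=> i _; rewrite mul1n.
by apply: dhomog_prod_exp => i _; apply: linform_homog.
Qed.

Lemma dderiv_is_linear v : linear (dderiv^~ v).
Proof.
move=> c p q; rewrite /dderiv scaler_sumr -big_split; apply: eq_bigr => i _ /=.
by rewrite mderivD mderivZ scalerDr !scalerA mulrC.
Qed.

(* The derivation [D_v], with the arguments of [dderiv] swapped so that its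
   linearity in the form can be registered as a structure. *)
Definition dder v f := dderiv f v.
HB.instance Definition _ v := GRing.isLinear.Build F {mpoly F[n]} {mpoly F[n]} _
  (dder v) (dderiv_is_linear v).

Lemma dderP c v w f : dder (c *: v + w) f = c *: dder v f + dder w f.
Proof.
rewrite /dder /dderiv scaler_sumr -big_split; apply: eq_bigr => i _ /=.
by rewrite !mxE scalerDl scalerA.
Qed.

Lemma dder0 f : dder 0 f = 0.
Proof. by rewrite /dder /dderiv big1 // => i _; rewrite mxE scale0r. Qed.

Lemma dderZ c v f : dder (c *: v) f = c *: dder v f.
Proof. by rewrite -[_ *: v]addr0 dderP dder0 addr0. Qed.

Lemma dder_sum (I : finType) (P : pred I) (c : I -> F) (w : I -> 'rV[F]_n) f :
  dder (\sum_(i | P i) c i *: w i) f = \sum_(i | P i) c i *: dder (w i) f.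
Proof.
by elim/big_rec2: _ => [|i y x _ <-]; [apply: dder0 | apply: dderP].
Qed.

Lemma dderC v c : dder v c%:MP = 0.
Proof. by rewrite /dder /dderiv big1 // => i _; rewrite mderivC scaler0. Qed.

Lemma dderX v i : dder v 'X_i = (v 0 i)%:MP.
Proof.
rewrite /dder /dderiv (bigD1 i) //= mderivX mnm1E eqxx.
rewrite -[X in (X - _)%MM]add0m addmK mpolyX0 scale1r.
rewrite big1 ?addr0 => [|j ji]; first by rewrite -mul_mpolyC mulr1.
by rewrite mderivX mnm1E eq_sym (negPf ji) scale0r scaler0.
Qed.

Lemma dderM v p q : dder v (p * q) = dder v p * q + p * dder v q.
Proof.
rewrite /dder /dderiv mulr_suml mulr_sumr -big_split; apply: eq_bigr => i _ /=.
by rewrite mderivM scalerDr scalerAl scalerAr.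
Qed.

Lemma dder_comm v w f : dder v (dder w f) = dder w (dder v f).
Proof.
rewrite {1}/dder /dderiv [RHS]raddf_sum /=; apply: eq_bigr => i _.
rewrite [RHS]linearZ /=; congr (_ *: _); rewrite /dder /dderiv raddf_sum /=.
by apply: eq_bigr => j _; rewrite mderivZ mderiv_comm.
Qed.

(** The chain rule for [x |-> x *m M]. The Leibniz rule and multiplicativity of [msubst M] reduce it
    to constants and variables. *)
Lemma dder_msubst M v h : dder v (msubst M h) = msubst M (dder (v *m M) h).
Proof.
elim/mpoly_alg_ind: h => [c|i|p q IHp IHq|p q IHp IHq].
- by rewrite msubstC !dderC raddf0.
- rewrite msubstX dderX msubstC /linform raddf_sum mxE /=.
  rewrite raddf_sum /=; apply: eq_bigr => j _.
  by rewrite linearZ /= dderX -mul_mpolyC -mpolyCM mxE mulrC.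
- by rewrite !raddfD /= IHp IHq.
- by rewrite rmorphM /= !dderM rmorphD /= !rmorphM /= IHp IHq.
Qed.

Lemma dder_homog v d f : f \is d.+1.-homog -> dder v f \is d.-homog.
Proof.
move=> hf; apply: rpred_sum => i _; apply: rpredZ; apply/dhomogP => m.
rewrite mcoeff_msupp mcoeff_mderiv => cm.
have : (m + U_(i))%MM \in msupp f.
  by rewrite mcoeff_msupp; apply: contraNneq cm => ->; rewrite mul0rn.
by move=> /(dhomog_mf hf) /=; rewrite mdegD mdeg1 addn1 => -[].
Qed.

Lemma dder_delta i f : dder (delta_mx 0 i) f = f^`M(i).
Proof.
rewrite /dder /dderiv (bigD1 i) //= mxE !eqxx scale1r big1 ?addr0 // => j ji.
by rewrite mxE (negPf ji) andbF scale0r.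
Qed.

End LinearSubstitution.

(** A monomial [m] of positive degree has some [m i != 0], and the [i]-th partial derivative
    multiplies its coefficient by [m i], which is invertible in characteristic zero. *)
Lemma dder_eq0 (F : numFieldType) n d (f : {mpoly F[n]}) :
  f \is d.+1.-homog -> (forall v, dder v f = 0) -> f = 0.
Proof.
move=> hf f0; apply/mpolyP => m; rewrite mcoeff0; apply/eqP.
apply: contraTT isT => fm; have ms: m \in msupp f by rewrite mcoeff_msupp.
have [i mi] : exists i, m i != 0%N.
  apply/existsP; rewrite -negb_forall; apply/negP => /forallP m0.
  have := dhomog_mf hf ms; rewrite /= mdegE big1 // => i _.
  by apply/eqP; move: (m0 i).
have /mpolyP/(_ (m - U_(i))%MM) := f0 (delta_mx 0 i).
rewrite dder_delta mcoeff_mderiv submK ?lep1mP // mcoeff0 => /eqP.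
by rewrite mulrn_eq0 (negPf fm).
Qed.


(** * Joint eigenspaces of a family permuted by the group *)

Section JointEigenspaces.
Context {F : fieldType} {n : nat} {I : finType}.
Variable A : I -> 'M[F]_n.
Implicit Types chi psi : {ffun I -> F}.

Definition joint_eigenspace chi : 'M[F]_n :=
  (\bigcap_i eigenspace (A i) (chi i))%MS.

Lemma joint_eigenspaceP m (v : 'M_(m, n)) chi :
  reflect (forall i, v *m A i = chi i *: v) (v <= joint_eigenspace chi)%MS.
Proof.
apply: (iffP sub_bigcapmxP) => [h i|h i _]; last exact/eigenspaceP.
by apply/eigenspaceP; apply: h.
Qed.

Lemma joint_eigenspace_inj m (v : 'M_(m, n)) chi psi :
  v != 0 -> (v <= joint_eigenspace chi)%MS -> (v <= joint_eigenspace psi)%MS ->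
  chi = psi.
Proof.
move=> v0 /joint_eigenspaceP h1 /joint_eigenspaceP h2; apply/ffunP => i.
apply/eqP; rewrite -subr_eq0; have: (chi i - psi i) *: v == 0.
  by rewrite scalerBl -h1 -h2 subrr.
by rewrite scalemx_eq0 (negPf v0) orbF.
Qed.

Section Direct.
Variables (J : finType) (chi : J -> {ffun I -> F}).
Hypothesis chi_inj : injective chi.

Lemma joint_eigenvectors_free (s : seq J) (x : J -> 'rV[F]_n) :
  uniq s -> (forall j, x j <= joint_eigenspace (chi j))%MS ->
  \sum_(j <- s) x j = 0 -> forall j, j \in s -> x j = 0.
Proof.
elim: s x => // a s IHs x /= /andP[as_ us] hx; rewrite big_cons => sum0.
have xs0 j : j \in s -> x j = 0.
  move=> js; have [i chi_i] : exists i, chi j i != chi a i.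
    apply/existsP; rewrite -negb_forall; apply: contra as_ => /forallP eq_chi.
    suff <- : j = a by [].
    by apply: chi_inj; apply/ffunP => i; apply/eqP; apply: eq_chi.
  suff /eqP: (chi j i - chi a i) *: x j = 0.
    by rewrite scaler_eq0 subr_eq0 (negPf chi_i) => /eqP.
  (* Multiplying the relation by [A i - chi a i] kills the term of [a] and leaves a relation over
     [s]. *)
  apply: (IHs (fun k => (chi k i - chi a i) *: x k)) us _ _ _ js => [k|].
    exact: scalemx_sub.
  rewrite (eq_bigr (fun k => x k *m A i - chi a i *: x k)); last first.
    by move=> k _; rewrite scalerBl; have /joint_eigenspaceP-> := hx k.
  rewrite sumrB -mulmx_suml -scaler_sumr; move/eqP: sum0.
  rewrite addrC addr_eq0 => /eqP->; rewrite mulNmx scalerN.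
  by have /joint_eigenspaceP-> := hx a; rewrite opprK addrC subrr.
move=> j; rewrite inE => /orP[/eqP->|/xs0//].
by move: sum0; rewrite big_seq big1 ?addr0.
Qed.

Lemma joint_eigenspace_direct :
  mxdirect (\sum_(j : J) joint_eigenspace (chi j)).
Proof.
apply/mxdirect_sumsP => j _; apply/eqP; rewrite -submx0.
apply/row_subP => k; set v := row k _; have := row_sub k _ : (v <= _)%MS.
move: v => v; rewrite sub_capmx => /andP[vj /sub_sumsmxP[u defv]].
(* Since [v] lies both in the [j]-th eigenspace and in the sum of the others, [-v] completes a
   vanishing sum of eigenvectors. *)
pose x i := if i == j then - v else u i *m joint_eigenspace (chi i).
have hx i : (x i <= joint_eigenspace (chi i))%MS.
  rewrite /x; case: eqP => [->|_]; last exact: submxMl.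
  by rewrite -scaleN1r scalemx_sub.
have : x j = 0.
  apply: (joint_eigenvectors_free (index_enum_uniq J) hx); last first.
    exact: mem_index_enum.
  rewrite (bigD1 j) //= {1}/x eqxx {1}defv addrC -sumrB big1 // => i ij.
  by rewrite /x (negPf ij) subrr.
by rewrite /x eqxx => /eqP; rewrite oppr_eq0 => /eqP->; rewrite sub0mx.
Qed.

End Direct.

(** The translates of one joint eigenspace are joint eigenspaces, so the distinct ones form a direct
    sum, which is all of [V] by irreducibility. Two or more of them would be a system of
    imprimitivity. *)
Lemma primitive_joint_eigenspace (gT : finGroupType) (G : {group gT})
    (rG : mx_representation F G n) chi0 :
  mx_irreducible rG -> primitive_module rG ->
  (forall g chi, g \in G ->
     exists psi, (joint_eigenspace chi *m rG g <= joint_eigenspace psi)%MS) ->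
  joint_eigenspace chi0 != 0 -> (1%:M <= joint_eigenspace chi0)%MS.
Proof.
move=> irrG primG perm nz0.
have [chg chgP] : exists chg : gT -> {ffun I -> F}, forall g, g \in G ->
    (joint_eigenspace chi0 *m rG g == joint_eigenspace (chg g))%MS.
  apply: (@fin_all_exists _ (fun=> {ffun I -> F}) (fun g c => g \in G ->
    (joint_eigenspace chi0 *m rG g == joint_eigenspace c)%MS)) => g.
  case Gg: (g \in G); last by exists chi0.
  have [psi le_psi] := perm g chi0 Gg; exists psi => _.
  rewrite /eqmx le_psi /=.
  (* [perm] gives only an inclusion. Translating back by [g^-1] puts the nonzero eigenspace of
     [chi0] inside that of [phi], so [phi = chi0] and the inclusion is an equality. *)
  have [phi le_phi] := perm _ psi (groupVr Gg).
  have e0 : joint_eigenspace chi0 *m rG g *m rG g^-1%g = joint_eigenspace chi0.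
    by rewrite repr_mxK.
  suff eq_phi : phi = chi0.
    by rewrite -(repr_mxKV rG Gg (joint_eigenspace psi)) submxMr -?eq_phi.
  apply: (joint_eigenspace_inj nz0) => //; rewrite -e0.
  by apply: submx_trans le_phi; apply: submxMr.
(* Without duplicates, distinct indices carry distinct eigenvalue functions, as directness
   requires. *)
pose X := undup [seq chg g | g <- enum G].
pose W (i : 'I_(size X)) := joint_eigenspace (nth chi0 X i).
have idx g : g \in G -> exists i : 'I_(size X), nth chi0 X i = chg g.
  move=> Gg; have Xg: chg g \in X.
    by rewrite mem_undup; apply: map_f; rewrite mem_enum.
  have lt_g : (index (chg g) X < size X)%N by rewrite index_mem.
  by exists (Ordinal lt_g); rewrite /= nth_index.
have rep (i : 'I_(size X)) : exists2 g, g \in G & nth chi0 X i = chg g.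
  have := mem_nth chi0 (ltn_ord i).
  rewrite mem_undup => /mapP[g]; rewrite mem_enum => Gg ->; by exists g.
have actW i g : g \in G -> exists j, (W i *m rG g == W j)%MS.
  move=> Gg; have [h Gh eh] := rep i; have [j ej] := idx _ (groupM Gh Gg).
  exists j; rewrite /W eh ej; apply/eqmxP.
  apply: eqmx_trans (eqmxP (chgP _ (groupM Gh Gg))).
  rewrite repr_mxM // mulmxA; apply: eqmxMr.
  exact/eqmx_sym/eqmxP/chgP.
have sum1 : (\sum_i W i :=: 1%:M)%MS.
  have [_ _ sim] := irrG.
  apply/eqmxP; rewrite submx1 /= sim ?submx1 //.
    apply/mxmoduleP => g Gg; rewrite sumsmxMr; apply/sumsmx_subP => i _.
    have [j /eqmxP ->] := actW i g Gg; exact: (sumsmx_sup j).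
  have [i ei] := idx _ (group1 G); apply: contraNneq nz0 => s0.
  rewrite -submx0 -s0 (sumsmx_sup i) // /W ei.
  by have /andP[+ _] := chgP _ (group1 G); rewrite repr_mx1 mulmx1.
(* A single block must be the one reached by the identity, namely the eigenspace of [chi0]. *)
rewrite -sum1; case: (leqP (size X) 1) => [leX|ltX].
  apply/sumsmx_subP => i _; have [j ej] := idx _ (group1 G).
  have -> : i = j.
    by apply: val_inj => /=; case: i j {ej} leX => [[|i] lei] [[|j] lej] /=;
       case: (size X) lei lej => [|[|]].
  rewrite /W ej; by have /andP[_] := chgP _ (group1 G); rewrite repr_mx1 mulmx1.
case: (primG _ W); split=> //.
- split; last exact/eqmxP.
  apply: joint_eigenspace_direct => i j /eqP.
  by rewrite nth_uniq ?undup_uniq // => /eqP/val_inj.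
- move=> i; have [g Gg eg] := rep i; apply: contraNneq nz0; rewrite /W eg => W0.
  rewrite -(repr_mxK rG Gg (joint_eigenspace chi0)) -submx0.
  rewrite -[X in (_ <= X)%MS](mul0mx _ (rG g^-1%g)) -W0.
  by apply: submxMr; have /andP[] := chgP _ Gg.
- by move=> g Gg i; apply: actW; rewrite groupV.
- move=> i j; have [h Gh eh] := rep i; have [k Gk ek] := rep j.
  (* The definition moves blocks by the matrix of the inverse, here [h^-1 * k], which goes from
     block [i] back to [chi0] and then to block [j]. *)
  exists (k^-1 * h)%g; first by rewrite groupM ?groupV.
  rewrite /W eh ek invMg invgK; apply/eqmxP.
  have e : (h * (h^-1 * k) = k)%g by rewrite mulKVg.
  apply: eqmx_trans (eqmxP (chgP _ Gk)); rewrite -{2}e.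
  rewrite (repr_mxM rG Gh (groupM (groupVr Gh) Gk)) mulmxA; apply: eqmxMr.
  exact/eqmx_sym/eqmxP/chgP.
Qed.

End JointEigenspaces.

(** * Forms with invariant Jacobian on a primitive module *)

Section InvariantForms.
Context {F : fieldType} {gT : finGroupType} {G : {group gT}} {n : nat}.
Variable rG : mx_representation F G n.
Implicit Types (f q : {mpoly F[n]}) (v w : 'rV[F]_n).

(** The derivatives [D_v f] depend linearly on [v], so they already form a subspace. *)
Lemma jacobianP f q : jacobian f q <-> exists v, q = dder v f.
Proof.
split=> [[k [c [u [hu ->]]]]|[v ->]].
  have /fin_all_exists[w hw] : forall i, exists v, u i = dder v f.
    by move=> i; have [v _ <-] := hu i; exists v.
  exists (\sum_i c i *: w i); rewrite dder_sum.
  by apply: eq_bigr => i _; rewrite hw.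
exists 1%N, (fun=> 1), (fun=> dder v f); split=> [_|]; first by exists v.
by rewrite big_ord1 scale1r.
Qed.

Lemma lspan1P f q : lspan [set f]%classic q <-> exists c, q = c *: f.
Proof.
split=> [[k [c [u [hu ->]]]]|[c ->]].
  exists (\sum_i c i); rewrite scaler_suml; apply: eq_bigr => i _.
  by rewrite (hu i).
by exists 1%N, (fun=> c), (fun=> f); split=> //; rewrite big_ord1.
Qed.

Lemma dder_act g v q :
  dder v (form_act rG g q) = form_act rG g (dder (v *m rG g) q).
Proof. by rewrite !form_actE dder_msubst. Qed.

Lemma form_actK g : g \in G -> cancel (form_act rG g) (form_act rG g^-1%g).
Proof.
move=> Gg q; rewrite !form_actE msubst_comp repr_mxV //.
by rewrite mulVmx ?msubst1 ?repr_mx_unit.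
Qed.

(** Stability suffices for equality because [G] also contains the inverses. *)
Lemma form_invariantP (U : set {mpoly F[n]}) :
  form_invariant rG U <-> forall g q, g \in G -> U q -> U (form_act rG g q).
Proof.
split=> [invU g q Gg Uq|stabU g Gg].
  by rewrite -(invU g Gg); exists q.
apply/seteqP; split=> [_ [q Uq <-]|q Uq]; first exact: stabU.
exists (form_act rG g^-1%g q); first by apply: stabU; rewrite ?groupV.
by rewrite -{1}[g]invgK form_actK ?groupV.
Qed.

(** Preimages in [V] are chosen for the standard basis and extended linearly. *)
Lemma jacobian_invariant_mx f : form_invariant rG (jacobian f) ->
  exists B : gT -> 'M[F]_n, forall g, g \in G ->
    forall v, form_act rG g (dder v f) = dder (v *m B g) f.
Proof.
move/form_invariantP => invJ.
apply: (@fin_all_exists _ (fun=> 'M[F]_n) (fun g B => g \in G ->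
  forall v, form_act rG g (dder v f) = dder (v *m B) f)) => g.
case Gg: (g \in G); last by exists 0.
have /fin_all_exists[w hw] : forall i, exists v,
    form_act rG g (dder (delta_mx 0 i) f) = dder v f.
  by move=> i; apply/jacobianP/invJ => //; apply/jacobianP; eexists.
exists (\matrix_i w i) => _ v.
rewrite {1}[v]row_sum_delta dder_sum mulmx_sum_row dder_sum form_actE raddf_sum.
by apply: eq_bigr => i _; rewrite rowK -hw form_actE; exact: linearZ.
Qed.

End InvariantForms.

Section PrimitiveForms.
Context {F : numClosedFieldType} {gT : finGroupType} {G : {group gT}} {n : nat}.
Variables (rG : mx_representation F G n) (d : nat) (f : {mpoly F[n]}).
Hypotheses (irrG : mx_irreducible rG) (f_homog : f \is d.+3.-homog).
Hypotheses (f_neq0 : f != 0) (invJ : form_invariant rG (jacobian f)).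
Implicit Types (u v w : 'rV[F]_n).

(** The annihilator of [f] in [V] is a submodule: [g] takes [D_(v g) D_w f] to [D_v (g D_w f)], and
    [g D_w f] is again a derivative [D_w' f], so this is [D_w' D_v f = 0]. By irreducibility a
    nonzero [v] would make all derivatives of [f] vanish. *)
Lemma dder_inj v : dder v f = 0 -> v = 0.
Proof.
have [B hB] := jacobian_invariant_mx invJ.
move=> dvf0; apply/eqP; apply: contraNT f_neq0 => v0; apply/eqP.
have orbit0 g : g \in G -> dder (v *m rG g) f = 0.
  move=> Gg; apply: (@dder_eq0 _ _ d.+1) => [|w]; first exact: dder_homog.
  apply: (can_inj (form_actK rG Gg)).
  rewrite dder_comm -dder_act hB // dder_comm dvf0 !form_actE.
  by rewrite !raddf0.
have [_ _ sim] := irrG.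
apply: (dder_eq0 f_homog) => w.
have : (w <= cyclic_mx rG v)%MS.
  apply: submx_trans (submx1 _) _; apply: sim; rewrite ?submx1 ?cyclic_mx_eq0 //.
  exact: cyclic_mx_module.
case/cyclic_mxP => _ /envelop_mxP[c ->] ->; rewrite mulmx_sumr.
under eq_bigr => g _ do rewrite -scalemxAr.
by rewrite dder_sum big1 // => g Gg; rewrite orbit0 ?scaler0.
Qed.

Lemma dder_ext (M N : 'M[F]_n) :
  (forall v, dder (v *m M) f = dder (v *m N) f) -> M = N.
Proof.
move=> eqMN; apply/row_matrixP => i; rewrite !rowE.
apply/eqP; rewrite -subr_eq0; apply/eqP/dder_inj.
by rewrite addrC -scaleN1r dderP eqMN scaleN1r addNr.
Qed.

(** In [D_(u M N) D_v D_w f] and in [D_(u N M) D_v D_w f] alike, [N] can be moved onto [v] and [M]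
    onto [w]. With separate arguments to receive them, their order no longer matters. *)
Lemma self_adjoint_comm (M N : 'M[F]_n) :
    (forall u v, dder (u *m M) (dder v f) = dder u (dder (v *m M) f)) ->
    (forall u v, dder (u *m N) (dder v f) = dder u (dder (v *m N) f)) ->
  M *m N = N *m M.
Proof.
have adj3 K : (forall u v, dder (u *m K) (dder v f) = dder u (dder (v *m K) f)) ->
    forall u v w, dder (u *m K) (dder v (dder w f)) =
                  dder u (dder (v *m K) (dder w f)).
  move=> hK u v w; rewrite (dder_comm v w) dder_comm hK dder_comm.
  by congr dder; apply: dder_comm.
move=> /adj3 hM /adj3 hN; apply: dder_ext => u; apply/eqP.
have eqT v w : dder (u *m (M *m N)) (dder v (dder w f)) =
               dder (u *m (N *m M)) (dder v (dder w f)).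
  rewrite !mulmxA hN (dder_comm (v *m N)) hM.
  by rewrite (dder_comm v w) hM (dder_comm _ v) hN (dder_comm (w *m M)).
set p := dder _ f; set q := dder _ f; rewrite -subr_eq0; apply/eqP.
(* Degree at least 2 here, that is at least 3 for [f], lets second derivatives detect [p - q]. *)
have pq_homog : p - q \is d.+2.-homog by apply: rpredB; apply: dder_homog.
apply: (dder_eq0 pq_homog) => v.
apply: (dder_eq0 (dder_homog v pq_homog)) => w; rewrite !raddfB /=.
apply/eqP; rewrite subr_eq0 /p /q; apply/eqP.
by rewrite 2!(dder_comm _ (u *m (M *m N))) 2!(dder_comm _ (u *m (N *m M))) eqT.
Qed.

Lemma primitive_form : primitive_module rG ->
  forall g, g \in G -> exists c, form_act rG g f = c *: f.
Proof.
move=> primG; have [B hB] := jacobian_invariant_mx invJ.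
have Gval (x : subg_of G) : sgval x \in G := subgP x.
(* This is the operator [A_g] with [D_v (g f) = D_(v A_g) f]; the subgroup type indexes the family
   by elements of [G] only. *)
pose A (x : subg_of G) := rG (sgval x) *m B (sgval x).
have hA x v : dder v (form_act rG (sgval x) f) = dder (v *m A x) f.
  by rewrite dder_act hB ?mulmxA.
have adjA x u v : dder (u *m A x) (dder v f) = dder u (dder (v *m A x) f).
  by rewrite dder_comm -!hA dder_comm.
have commA x y : A x *m A y = A y *m A x by apply: self_adjoint_comm.
(* The cocycle relation comes from computing [D_v (x (y f))] in two ways, using that [B] at [x] is
   the inverse of [rG x] times [A x]. *)
have AM x y : A (x * y)%g = rG (sgval x) *m A y *m rG (sgval x)^-1%g *m A x.
  have -> : rG (sgval x)^-1%g = invmx (rG (sgval x)) by rewrite repr_mxV.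
  rewrite -mulmxA mulKmx ?repr_mx_unit //.
  apply: dder_ext => v; rewrite -hA.
  rewrite !form_actE /= repr_mxM // -msubst_comp dder_msubst.
  by rewrite -!form_actE hA hB // !mulmxA.
have A1 : A 1%g = 1%:M.
  apply: dder_ext => v; rewrite -hA /= form_actE repr_mx1 msubst1.
  by rewrite mulmx1.
clearbody A.
have n_gt0 : (0 < n)%N by have /mx_irrP[] := irrG.
have [|v0 v0_neq0 /allP stab_v0] := @common_eigenvector _ _ (codom A) n_gt0.
  by move=> _ _ /codomP[x ->] /codomP[y ->]; apply: commA.
have [chi hchi] : exists chi : {ffun subg_of G -> F},
    (v0 <= joint_eigenspace A chi)%MS.
  have /fin_all_exists[c hc] : forall x, exists c, v0 *m A x = c *: v0.
    by move=> x; apply/sub_rVP/stab_v0/codom_f.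
  by exists (finfun c); apply/joint_eigenspaceP => x; rewrite ffunE.
have perm g chi' : g \in G -> exists psi,
    (joint_eigenspace A chi' *m rG g <= joint_eigenspace A psi)%MS.
  move=> Gg; pose x := subg G g; have xg : sgval x = g by apply: subgK.
  (* By [AM], the conjugate of [A y] by [rG g] is [A (x * y)] times the inverse of [A x], which acts
     on [E] by this quotient. *)
  exists [ffun y => chi' (x * y)%g / chi' x].
  apply/joint_eigenspaceP => y; rewrite ffunE; set E := joint_eigenspace A chi'.
  have hE : forall z, E *m A z = chi' z *: E by apply/joint_eigenspaceP.
  have [L AVx] : exists L, A x *m L = 1%:M.
    (* The cocycle relation for [x * x^-1] makes this a left inverse of [A x]. *)
    exists (rG g *m A x^-1%g *m rG g^-1%g).
    by apply: mulmx1C; rewrite -A1 -[in RHS](mulgV x) AM xg.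
  have EL : E *m L = (chi' x)^-1 *: E.
    have EE : chi' x *: (E *m L) = E by rewrite scalemxAl -hE -mulmxA AVx mulmx1.
    (* If [chi' x = 0] then [E = 0], and the convention for the inverse of zero is harmless. *)
    have [c0|c_neq0] := eqVneq (chi' x) 0.
      by rewrite c0 invr0 scale0r -{1}EE c0 scale0r mul0mx.
    by rewrite -{2}EE scalerA mulVf // scale1r.
  have : E *m A (x * y)%g *m L = (chi' (x * y)%g / chi' x) *: E.
    by rewrite hE -scalemxAl EL scalerA.
  rewrite AM xg -!mulmxA AVx mulmx1 => /(congr1 (mulmx^~ (rG g))).
  by rewrite !mulmxA repr_mxKV // -scalemxAl.
have nz : joint_eigenspace A chi != 0.
  by apply: contraNneq v0_neq0 => E0; rewrite -submx0 -E0.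
have /joint_eigenspaceP full := primitive_joint_eigenspace irrG primG perm nz.
move=> g Gg; have xg : sgval (subg G g) = g by apply: subgK.
(* All of [V] is one joint eigenspace, so [g f] and this multiple of [f] have the same
   derivatives. *)
exists (chi (subg G g)); apply/eqP; rewrite -subr_eq0; apply/eqP.
apply: (@dder_eq0 _ _ d.+2) => [|v].
  by apply: rpredB; rewrite ?rpredZ // form_actE msubst_homog.
rewrite raddfB /= -{1}xg hA -[A _]mul1mx full -scalemxAr mulmx1 dderZ.
by apply/eqP; rewrite subr_eq0; apply/eqP/esym/linearZ.
Qed.

End PrimitiveForms.

(** * Forms on an imprimitive module *)

Lemma direct_sum_projections (F : fieldType) n r (W : 'I_r -> 'M[F]_n) :
    mxdirect (\sum_i W i) -> (\sum_i W i == 1%:M)%MS ->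
  exists pi : 'I_r -> 'M[F]_n,
    [/\ forall i j m (w : 'M_(m, n)), (w <= W i)%MS ->
          w *m pi j = if i == j then w else 0,
        forall i, (pi i <= W i)%MS & \sum_i pi i = 1%:M].
Proof.
move=> /mxdirect_sumsP dxW /andP[_ /sub_sumsmxP[u def1]].
pose pi i := proj_mx (W i) (\sum_(j | j != i) W j)%MS.
have piE i j m (w : 'M_(m, n)) : (w <= W i)%MS ->
    w *m pi j = if i == j then w else 0.
  move=> wi; case: eqVneq => [<-|ij]; first by rewrite proj_mx_id ?dxW.
  by rewrite proj_mx_0 ?dxW // (sumsmx_sup i).
exists pi; split=> // [i|]; first by rewrite -[pi i]mul1mx proj_mx_sub.
rewrite -[LHS]mul1mx {1}def1 mulmx_suml def1; apply: eq_bigr => i _.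
rewrite mulmx_sumr (bigD1 i) //= (piE i) ?submxMl // eqxx big1 ?addr0 // => j ji.
by rewrite (piE i) ?submxMl // eq_sym (negPf ji).
Qed.

Section ImprimitiveForms.
Context {F : numFieldType} {gT : finGroupType} {G : {group gT}} {n r : nat}.
Variables (rG : mx_representation F G n) (W : 'I_r -> 'M[F]_n).
Hypothesis imprimW : imprimitivity_system rG W.
Implicit Types (i j k : 'I_r) (g h : gT) (c : 'I_r -> F).

Variable pi : 'I_r -> 'M[F]_n.
Hypothesis piE : forall i j m (w : 'M_(m, n)), (w <= W i)%MS ->
  w *m pi j = if i == j then w else 0.
Hypothesis pi_sub : forall i, (pi i <= W i)%MS.
Hypothesis pi_sum : \sum_i pi i = 1%:M.

(* A right action: [perm_block g] is the permutation of the blocks by [g^-1]. *)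
Let perm_block g i := odflt i [pick j | (W i *m rG g == W j)%MS].

Lemma block_inj i j : (W i == W j)%MS -> i = j.
Proof.
have [_ _ nzW _ _] := imprimW; case/andP=> ij _.
apply/eqP; apply: contraNT (nzW i) => neq_ij.
have := piE i (submx_refl (W i)).
by rewrite eqxx (piE i ij) (eq_sym j) (negPf neq_ij) => /esym/eqP.
Qed.

Lemma perm_blockP g i : g \in G -> (W i *m rG g == W (perm_block g i))%MS.
Proof.
have [_ _ _ actW _] := imprimW => Gg; rewrite /perm_block.
case: pickP => [j //|no_j].
have [j] := actW g^-1%g (groupVr Gg) i; rewrite invgK => ij.
by have := no_j j; rewrite /= ij.
Qed.

Lemma perm_blockE g i j :
  g \in G -> (W i *m rG g == W j)%MS -> perm_block g i = j.
Proof.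
move=> Gg ij; apply: block_inj; apply/eqmxP.
apply: eqmx_trans (eqmxP ij); exact/eqmx_sym/eqmxP/perm_blockP.
Qed.

Lemma perm_blockM g h i : g \in G -> h \in G ->
  perm_block (g * h)%g i = perm_block h (perm_block g i).
Proof.
move=> Gg Gh; apply: perm_blockE; rewrite ?groupM //; apply/eqmxP.
rewrite repr_mxM // mulmxA; apply: eqmx_trans (eqmxP (perm_blockP _ Gh)).
exact/eqmxMr/eqmxP/perm_blockP.
Qed.

Lemma perm_block1 i : perm_block 1%g i = i.
Proof. by apply: perm_blockE => //; rewrite repr_mx1 mulmx1; apply/eqmxP. Qed.

Lemma perm_blockK g : g \in G -> cancel (perm_block g) (perm_block g^-1%g).
Proof. by move=> Gg i; rewrite -perm_blockM ?groupV // mulgV perm_block1. Qed.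

Lemma perm_blockKV g : g \in G -> cancel (perm_block g^-1%g) (perm_block g).
Proof. by move=> Gg i; rewrite -perm_blockM ?groupV // mulVg perm_block1. Qed.

Lemma perm_block_trans i j : exists2 g, g \in G & perm_block g i = j.
Proof.
have [_ _ _ _ transW] := imprimW; have [g Gg ij] := transW i j.
by exists g^-1%g; rewrite ?groupV //; apply: perm_blockE; rewrite ?groupV.
Qed.

(** Each [pi k *m rG g] lands in the block [perm_block g k]; projecting the sum of these matrices
    onto [perm_block g i] keeps only [k = i]. *)
Lemma proj_block g i : g \in G -> pi i *m rG g = rG g *m pi (perm_block g i).
Proof.
move=> Gg; rewrite -[rG g in RHS]mul1mx -pi_sum !mulmx_suml.
have pi_g k : (pi k *m rG g <= W (perm_block g k))%MS.
  by have /andP[+ _] := perm_blockP k Gg; apply: submx_trans; apply: submxMr.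
rewrite (bigD1 i) //= (piE _ (pi_g i)) eqxx big1 ?addr0 // => k ki.
by rewrite (piE _ (pi_g k)) (can_eq (perm_blockK Gg)) (negPf ki).
Qed.

(** * A form supported on each block *)

Variables (i0 : 'I_r) (u : 'cV[F]_n).
Hypotheses (u_neq0 : u != 0) (u_fix : pi i0 *m u = u).

(** The column [u] is a linear form vanishing on the blocks other than [W i0]. Taking all [g] with
    [perm_block g i == i0] lets [G] permute these products with no scalar factors; the cubes ensure
    degree at least 3. *)
Let block_form i :=
  \prod_(g in G | perm_block g i == i0) linform (rG g *m u) ^+ 3.

Lemma block_form_neq0 i : block_form i != 0.
Proof.
apply/prodf_neq0 => g /andP[Gg _]; rewrite expf_neq0 // linform_eq0.
apply: contraNneq u_neq0 => gu0.
by rewrite -[u](mulKmx (repr_mx_unit rG Gg)) gu0 mulmx0.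
Qed.

Lemma block_form_act g i : g \in G ->
  form_act rG g (block_form i) = block_form (perm_block g^-1%g i).
Proof.
move=> Gg; rewrite form_actE rmorph_prod.
rewrite /block_form [RHS](reindex_inj (mulgI g)) /=.
apply: eq_big => [h|h /andP[Gh _]]; last first.
  by rewrite rmorphXn /= msubst_linform repr_mxM // mulmxA.
rewrite groupMl //; case Gh: (h \in G) => //=.
by rewrite perm_blockM // perm_blockKV.
Qed.

Lemma block_form_proj k i :
  msubst (pi k) (block_form i) = if k == i then block_form i else 0.
Proof.
rewrite rmorph_prod /=; case: eqVneq => [->|ki].
  apply: eq_bigr => g /andP[Gg /eqP gi]; rewrite rmorphXn /= msubst_linform.
  by rewrite mulmxA proj_block // gi -mulmxA u_fix.
(* For [k != i] one vanishing factor is enough, and transitivity guarantees that the product has a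
   factor. *)
have [g Gg gi] := perm_block_trans i i0.
rewrite (bigD1 g) ?Gg ?gi //= rmorphXn /= msubst_linform mulmxA proj_block //.
rewrite -mulmxA; have -> : pi (perm_block g k) *m u = 0.
  rewrite -u_fix mulmxA (piE _ (pi_sub _)) -gi (can_eq (perm_blockK Gg)).
  by rewrite (negPf ki) mul0mx.
by rewrite mulmx0 raddf0 expr0n mul0r.
Qed.

(** The form is its own pullback along [pi i], and [pi k *m pi i = 0]. *)
Lemma dder_block_form v k i : k != i -> dder (v *m pi k) (block_form i) = 0.
Proof.
move=> ki; have := block_form_proj i i; rewrite eqxx => <-.
rewrite dder_msubst -mulmxA (piE _ (pi_sub k)) (negPf ki) mulmx0.
by rewrite dder0 raddf0.
Qed.

Lemma block_form_homog :
  exists2 d, (3 <= d)%N & forall i, block_form i \is d.-homog.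
Proof.
(* The degree is counted at [i0], where the identity contributes a factor; the other block forms are
   translates of this one. *)
exists (\sum_(g in G | perm_block g i0 == i0) 1 * 3)%N.
  by rewrite (bigD1 1%g) //= group1 perm_block1 eqxx.
move=> i; have [g Gg gi] := perm_block_trans i i0.
have <- : form_act rG g (block_form i0) = block_form i.
  by rewrite block_form_act // -gi perm_blockK.
rewrite form_actE; apply/msubst_homog/dhomog_prod_exp => h _.
exact: linform_homog.
Qed.

(** * Combinations of the block forms and their Jacobians *)

Let combo c := \sum_i c i *: block_form i.

Lemma combo_act c g : g \in G ->
  form_act rG g (combo c) = combo (c \o perm_block g).
Proof.
move=> Gg; rewrite form_actE raddf_sum /combo.
rewrite (reindex_inj (can_inj (perm_blockK Gg))); apply: eq_bigr => i _ /=.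
have -> : msubst (rG g) (c (perm_block g i) *: block_form (perm_block g i)) =
    c (perm_block g i) *: form_act rG g (block_form (perm_block g i)).
  by rewrite form_actE; apply: linearZ.
by rewrite block_form_act // perm_blockK.
Qed.

Lemma combo_proj c k : msubst (pi k) (combo c) = c k *: block_form k.
Proof.
rewrite raddf_sum (bigD1 k) //= big1 => [|i ik].
  by rewrite addr0 [LHS]linearZ /= block_form_proj eqxx.
by rewrite [LHS]linearZ /= block_form_proj eq_sym (negPf ik) scaler0.
Qed.

(** The component of [v] in each block sees only that block's form, so changing coefficients amounts
    to rescaling the components of [v]. *)
Lemma combo_jacobian c c' q :
  (forall i, c i != 0) -> jacobian (combo c') q -> jacobian (combo c) q.
Proof.
move=> nzc /jacobianP[v ->]; apply/jacobianP.
have dder_combo e w : dder w (combo e) = \sum_i e i *: dder w (block_form i).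
  by rewrite raddf_sum; apply: eq_bigr => i _; apply: linearZ.
exists (\sum_i (c' i / c i) *: (v *m pi i)).
rewrite dder_combo dder_sum; apply: eq_bigr => i _.
rewrite dder_combo (bigD1 i) //= big1 => [|k ki]; last first.
  by rewrite dder_block_form 1?eq_sym ?scaler0.
rewrite addr0 scalerA mulfVK //; congr (_ *: _).
rewrite -[v in LHS]mulmx1 -pi_sum mulmx_sumr.
under eq_bigr => k _ do rewrite -[v *m _]scale1r.
rewrite dder_sum (bigD1 i) //= scale1r big1 ?addr0 // => k ki.
by rewrite dder_block_form ?scaler0.
Qed.

Lemma combo_form : exists d f, [/\ (3 <= d)%N, f \is d.-homog, f != 0,
  form_invariant rG (jacobian f) & ~ form_invariant rG (lspan [set f]%classic)].
Proof.
have [d le3d hd] := block_form_homog.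
(* The coefficients must be nonzero but not proportional to their permutation by an element that
   moves [i0]. *)
pose c i : F := if i == i0 then 2%:R else 1.
have nzc i : c i != 0 by rewrite /c; case: ifP; rewrite ?oner_eq0 ?pnatr_eq0.
exists d, (combo c); split=> //.
- by apply: rpred_sum => i _; apply: rpredZ; apply: hd.
- apply/eqP => f0; have := combo_proj c i0; rewrite f0 raddf0 => /esym/eqP.
  by rewrite scaler_eq0 (negPf (nzc _)) (negPf (block_form_neq0 _)).
- apply/form_invariantP => g _ Gg /jacobianP[v ->].
  apply: (@combo_jacobian c (c \o perm_block g)) => //; apply/jacobianP.
  by exists (v *m rG g^-1%g); rewrite -(combo_act c Gg) dder_act repr_mxKV.
move/form_invariantP => inv_f.
have [i1 neq10] : exists i, i != i0.
  have [lt1r _ _ _ _] := imprimW.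
  have : (0 < #|[set~ i0]|)%N by rewrite cardsC1 card_ord -subn1 subn_gt0.
  by case/card_gt0P => i; rewrite !inE; exists i.
have [g Gg g10] := perm_block_trans i1 i0.
have /lspan1P[a fa] : lspan [set combo c]%classic (form_act rG g (combo c)).
  by apply: inv_f => //; apply/lspan1P; exists 1; rewrite scale1r.
(* Pulling back along [pi k] isolates the coefficient of the [k]-th block form. *)
have ca k : c (perm_block g k) = a * c k.
  move/(congr1 (msubst (pi k))): fa; rewrite combo_act // [RHS]linearZ /=.
  rewrite !combo_proj scalerA /= => /eqP; rewrite -subr_eq0 -scalerBl.
  by rewrite scaler_eq0 (negPf (block_form_neq0 _)) orbF subr_eq0 => /eqP.
(* At [i1], which is sent to [i0], this gives [a = 2]; at [i0], which is sent elsewhere, it then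
   gives [1 = 2 * 2]. *)
have := ca i1; rewrite g10 /c eqxx (negPf neq10) mulr1 => a2.
have := ca i0; rewrite /c eqxx -a2 -{2}g10 (can_eq (perm_blockK Gg)).
rewrite eq_sym (negPf neq10) => /eqP.
by rewrite -natrM -[1]/(1%:R) eqr_nat.
Qed.

End ImprimitiveForms.

Lemma imprimitive_form (F : numFieldType) (gT : finGroupType) (G : {group gT})
    n r (rG : mx_representation F G n) (W : 'I_r -> 'M[F]_n) :
  imprimitivity_system rG W ->
  exists d f, [/\ (3 <= d)%N, f \is d.-homog, f != 0,
    form_invariant rG (jacobian f) & ~ form_invariant rG (lspan [set f]%classic)].
Proof.
move=> imprimW; have [lt1r [dxW sumW] nzW _ _] := imprimW.
have [pi [piE pi_sub pi_sum]] := direct_sum_projections dxW sumW.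
pose i0 : 'I_r := Ordinal (ltnW lt1r).
(* A nonzero column of the idempotent [pi i0] is fixed by [pi i0] and serves as [u]. *)
have [k nzk] : exists k, col k (pi i0) != 0.
  apply/existsP; rewrite -negb_forall; apply: contra (nzW i0) => /forallP pi0.
  have := piE i0 i0 _ _ (submx_refl (W i0)); rewrite eqxx => <-.
  suff -> : pi i0 = 0 by rewrite mulmx0.
  by apply/matrixP => i j; have /eqP/colP/(_ i) := pi0 j; rewrite !mxE.
apply: (combo_form imprimW piE pi_sub pi_sum nzk).
by rewrite colE mulmxA (piE i0) // eqxx.
Qed.

(** * Primitivity in terms of invariant Jacobians *)

Local Open Scope complex_scope.
Local Open Scope classical_set_scope.

Theorem theorem1p2 (R : realType) (gT : finGroupType) (G : {group gT})
    (n : nat) (rG : mx_representation R[i] G n) (irrG : mx_irreducible rG) :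
  primitive_module rG <->
  (forall (d : nat) (f : {mpoly R[i][n]}),
     (3 <= d)%N -> f \is d.-homog -> f != 0 ->
     form_invariant rG (jacobian f) -> form_invariant rG (lspan [set f])).
Proof.
split=> [primG [|[|[|d]]] // f _ f_homog f_neq0 invJ|inv_form r W imprimW].
  apply/form_invariantP => g _ Gg /lspan1P[a ->]; apply/lspan1P.
  have [c fc] := primitive_form irrG f_homog f_neq0 invJ primG Gg.
  exists (a * c); rewrite -scalerA -fc !form_actE; exact: linearZ.
have [d [f [le3d f_homog f_neq0 invJ]]] := imprimitive_form imprimW.
by apply; apply: inv_form le3d f_homog f_neq0 invJ.
Qed.
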